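(* Let $T$ be a positive theory with the joint embedding property in a single-sorted signature $L$ with monster model $\mathfrak M$, let $\mathcal E$ be a set of partial types as described in the context, and let $T^{\mathcal E}$ be the corresponding hyperimaginary theory. Then $T$ is NSOP$_1$ if and only if $T^{\mathcal E}$ is NSOP$_1$.
   Context: Positive logic: ''formula'' means positive existential formula (built from atomic formulas using $\wedge,\vee,\top,\bot,\exists$); a theory is a set of h-inductive sentences $\forall x(\varphi(x)\to\psi(x))$ with $\varphi,\psi$ positive existential; one works in a monster model (a very saturated, very homogeneous existentially closed model). SOP$_1$: a formula $\varphi(x,y)$ (possibly multi-sorted) has SOP$_1$ in a theory $T$ if there are a formula $\psi(y_1,y_2)$ and parameters $(a_\eta)_{\eta\in2^{<\omega}}$ in the monster such that (i) for every $\sigma\in2^\omega$ the set $\{\varphi(x,a_{\sigma|n}):n<\omega\}$ is consistent; (ii) $T\models\forall y_1y_2\neg[\psi(y_1,y_2)\wedge\exists x(\varphi(x,y_1)\wedge\varphi(x,y_2))]$; (iii) $\models\psi(a_{\eta^\frown1},a_\nu)$ whenever $\eta^\frown0\preceq\nu$. $T$ is NSOP$_1$ if no formula has SOP$_1$. Hyperimaginary extension: let $\mathcal E$ be a set of partial types $E(x,y)$ over $\emptyset$ ($x,y$ small tuples of the same length) each defining an equivalence relation on tuples of $\mathfrak M$. $L_{\mathcal E}$ is the multi-sorted signature with the real sort (carrying $L$), a sort $S_E$ for each $E\in\mathcal E$, and for all $E_1,\dots,E_n\in\mathcal E$ and each $L$-formula $\varphi(x,y_1,\dots,y_n)$ ($y_j$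 real tuples matching $E_j$) a relation symbol $R_\varphi(x,z_1,\dots,z_n)$ with $z_j$ of sort $S_{E_j}$. $\mathfrak M^{\mathcal E}$ has real sort $\mathfrak M$, sort $S_E$ the $E$-classes of tuples of $\mathfrak M$, and $R_\varphi(a,c_1,\dots,c_n)$ holds iff there are representatives $b_j$ of $c_j$ with $\mathfrak M\models\varphi(a,b_1,\dots,b_n)$. $T^{\mathcal E}$ is the set of h-inductive $L_{\mathcal E}$-sentences true in $\mathfrak M^{\mathcal E}$, with monster model $\mathfrak M^{\mathcal E}$. *)

(* Defs.v *)
From mathcomp Require Import all_boot.
From mathcomp Require Import boolp classical_sets functions cardinality.

Set Implicit Arguments.
Unset Strict Implicit.
Unset Printing Implicit Defensive.

Local Open Scope classical_set_scope.
Local Open Scope card_scope.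

(* Signatures with sorts in S; a single-sorted signature is a signature over
   unit.  The places of a symbol are indexed by a finite type, so that places
   of different kinds can be told apart without casts. *)
Record signature (S : Type) := Signature {
  fsym : Type;
  farity : fsym -> finType;
  fdom : forall f, farity f -> S;
  fcod : fsym -> S;
  rsym : Type;
  rarity : rsym -> finType;
  rdom : forall r, rarity r -> S }.
Arguments farity {S} _ _.
Arguments fdom {S _} _ _.
Arguments fcod {S _} _.
Arguments rarity {S} _ _.
Arguments rdom {S _} _ _.

(* A tuple of variables, finite or infinite, is a type V of places together
   with the sort s : V -> S of each of them. *)
Definition sum_sort (S V W : Type) (s : V -> S) (t : W -> S) (u : V + W) : S :=
  match u with inl v => s v | inr w => t w end.

Definition ext_sort (S V : Type) (s : V -> S) (t : S) (u : option V) : S :=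
  match u with Some v => s v | None => t end.

Inductive term (S : Type) (L : signature S) (V : Type) (s : V -> S) :
    S -> Type :=
  | Var (v : V) : term L s (s v)
  | App (f : fsym L) (args : forall i : farity L f, term L s (fdom f i)) :
      term L s (fcod f).

(* Positive existential formulas whose free variables are among s *)
Inductive formula (S : Type) (L : signature S) (V : Type) (s : V -> S) : Type :=
  | Rel (r : rsym L) (args : forall i : rarity L r, term L s (rdom r i))
  | Eq (t : S) (t1 t2 : term L s t)
  | Top
  | Bot
  | And (phi psi : formula L s)
  | Or (phi psi : formula L s)
  | Ex (t : S) (phi : formula L (ext_sort s t)).

Record structure (S : Type) (L : signature S) := Structure {
  carrier :> S -> Type;
  carrier_inhabited : forall t, inhabited (carrier t);
  fint : forall f : fsym L,
    (forall i : farity L f, carrier (fdom f i)) -> carrier (fcod f);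
  rint : forall r : rsym L,
    (forall i : rarity L r, carrier (rdom r i)) -> Prop }.

Section Semantics.
Context {S : Type} {L : signature S} (M : structure L).

Definition env {V : Type} (s : V -> S) : Type := forall v, M (s v).

Definition sum_env {V W : Type} {s : V -> S} {t : W -> S}
    (a : env s) (b : env t) : env (sum_sort s t) :=
  fun u => match u with inl v => a v | inr w => b w end.

Definition ext_env {V : Type} {s : V -> S} {t : S} (a : env s) (x : M t) :
    env (ext_sort s t) :=
  fun u => match u with Some v => a v | None => x end.

Fixpoint eval {V : Type} {s : V -> S} (a : env s) {t : S} (u : term L s t) :
    M t :=
  match u with
  | Var v => a v
  | App f args => fint (fun i => eval a (args i))
  end.

Fixpoint sat {V : Type} {s : V -> S} (phi : formula L s) : env s -> Prop :=
  match phi with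
  | Rel r args => fun a => rint (fun i => eval a (args i))
  | Eq t t1 t2 => fun a => eval a t1 = eval a t2
  | Top => fun=> True
  | Bot => fun=> False
  | And phi psi => fun a => sat phi a /\ sat psi a
  | Or phi psi => fun a => sat phi a \/ sat psi a
  | Ex t phi => fun a => exists x : M t, sat phi (ext_env a x)
  end.

End Semantics.

(* The h-inductive sentence forall x, hyp x -> concl x *)
Record hsentence (S : Type) (L : signature S) := HSentence {
  hsize : nat;
  hsort : 'I_hsize -> S;
  hyp : formula L hsort;
  concl : formula L hsort }.

Definition holds (S : Type) (L : signature S) (M : structure L)
    (chi : hsentence L) : Prop :=
  forall a : env M (@hsort _ _ chi), sat (hyp chi) a -> sat (concl chi) a.

Definition theory (S : Type) (L : signature S) : Type := set (hsentence L).

Definition is_model (S : Type) (L : signature S) (T : theory L)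
    (M : structure L) : Prop :=
  forall chi, T chi -> holds M chi.

Section Morphisms.
Context {S : Type} {L : signature S}.

Record homomorphism (M N : structure L) (h : forall t, M t -> N t) : Prop := {
  hom_fint : forall (f : fsym L) (a : forall i, M (fdom f i)),
    h _ (fint a) = fint (fun i => h _ (a i));
  hom_rint : forall (r : rsym L) (a : forall i, M (rdom r i)),
    rint a -> rint (fun i => h _ (a i)) }.

Definition immersion (M N : structure L) (h : forall t, M t -> N t) : Prop :=
  homomorphism h /\
  forall (n : nat) (s : 'I_n -> S) (phi : formula L s) (a : env M s),
    sat phi (fun v => h _ (a v)) -> sat phi a.

Definition automorphism (M : structure L) (h : forall t, M t -> M t) : Prop :=
  exists g : forall t, M t -> M t,
    [/\ homomorphism h, homomorphism g,
        forall t, cancel (h t) (g t) & forall t, cancel (g t) (h t)].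

Definition JEP (T : theory L) : Prop :=
  forall M1 M2 : structure L, is_model T M1 -> is_model T M2 ->
  exists (N : structure L) (h1 : forall t, M1 t -> N t)
         (h2 : forall t, M2 t -> N t),
    [/\ is_model T N, homomorphism h1 & homomorphism h2].

Definition existentially_closed (T : theory L) (M : structure L) : Prop :=
  is_model T M /\
  forall (N : structure L) (h : forall t, M t -> N t),
    is_model T N -> homomorphism h -> immersion h.

End Morphisms.

(* The cardinal of A is smaller than the one of K *)
Definition small (K A : Type) : Prop :=
  ([set: A] #<= [set: K]) && ~~ ([set: K] #<= [set: A]).

(* Monster models, with respect to the cardinal |K| below which sets and
   tuples are called small *)
Record monster (K : Type) (S : Type) (L : signature S) (T : theory L)
    (M : structure L) : Prop := {
  monster_nat : small K nat;
  monster_sort : small K S;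
  monster_fsym : small K (fsym L);
  monster_rsym : small K (rsym L);
  monster_ec : existentially_closed T M;
  monster_saturated :
    forall (V A : Type) (s : V -> S) (t : A -> S) (a : env M t),
    small K V -> small K A ->
    forall Sigma : set (formula L (sum_sort s t)),
    (forall Delta, finite_set Delta -> Delta `<=` Sigma ->
       exists b : env M s, forall phi, Delta phi -> sat phi (sum_env b a)) ->
    exists b : env M s, forall phi, Sigma phi -> sat phi (sum_env b a);
  monster_homogeneous :
    forall (A : Type) (s : A -> S) (a b : env M s), small K A ->
    (forall phi : formula L s, sat phi a <-> sat phi b) ->
    exists h : forall t, M t -> M t,
      automorphism h /\ forall i, h _ (a i) = b i }.

(* phi(x, y) has SOP_1 in T, with parameters in the monster model M; the nodes
   of the tree 2^{<omega} are the boolean sequences, with 0 = false, 1 = true,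
   and a set of formulas is consistent when it is realised in M. *)
Definition has_SOP1 (S : Type) (L : signature S) (T : theory L)
    (M : structure L) (n m : nat) (sx : 'I_n -> S) (sy : 'I_m -> S)
    (phi : formula L (sum_sort sx sy)) : Prop :=
  exists (psi : formula L (sum_sort sy sy)) (a : seq bool -> env M sy),
  [/\ forall sigma : nat -> bool, exists b : env M sx,
        forall k, sat phi (sum_env b (a (mkseq sigma k))),
      forall N : structure L, is_model T N -> forall y1 y2 : env N sy,
        ~ (sat psi (sum_env y1 y2) /\
           exists x : env N sx,
             sat phi (sum_env x y1) /\ sat phi (sum_env x y2))
    & forall eta nu : seq bool, prefix (rcons eta false) nu ->
        sat psi (sum_env (a (rcons eta true)) (a nu))].

Definition NSOP1 (S : Type) (L : signature S) (T : theory L)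
    (M : structure L) : Prop :=
  forall (n m : nat) (sx : 'I_n -> S) (sy : 'I_m -> S)
    (phi : formula L (sum_sort sx sy)), ~ has_SOP1 T M phi.

Section Hyperimaginaries.
Context (L : signature unit).

(* The sort of a tuple of real variables *)
Definition real (I : Type) (i : I) : unit := tt.
Arguments real I i : clear implicits.

Context (M : structure L).

(* The set of partial types, as a family indexed by J: E j is a set of formulas
   E(x, y), where the places of x and of y are indexed by len j. *)
Context (J : Type) (len : J -> Type)
  (E : forall j, set (formula L (sum_sort (real (len j)) (real (len j))))).

Definition Erel (j : J) (b b' : env M (real (len j))) : Prop :=
  forall phi, E phi -> sat phi (sum_env b b').

(* The symbol R_phi of an L-formula phi(x, y_1, ..., y_n) *)
Record hyp_rsym := HypRsym {
  hr_real : nat;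
  hr_num : nat;
  hr_type : 'I_hr_num -> J;
  hr_formula : formula L (sum_sort (real 'I_hr_real)
                                   (real {k : 'I_hr_num & len (hr_type k)})) }.

(* The real sort is inl tt, the sort S_E of E = E j is inr j. *)
Definition hyp_signature : signature (unit + J) :=
  @Signature (unit + J)%type
    (fsym L) (farity L) (fun f i => inl (fdom f i)) (fun f => inl (fcod f))
    (rsym L + hyp_rsym)%type
    (fun r => match r with
       | inl r => rarity L r
       | inr R => ('I_(hr_real R) + 'I_(hr_num R))%type : finType
       end)
    (fun r => match r with
       | inl r => fun i => inl (rdom r i)
       | inr R => fun i => match i with
           | inl _ => inl tt
           | inr k => inr (hr_type k)
           end
       end).

Definition Eclass (j : J) : Type :=
  {c : set (env M (real (len j))) | exists b, c = [set b' | Erel b b']}.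

Definition hyp_carrier (t : unit + J) : Type :=
  match t with inl u => M u | inr j => Eclass j end.

Fact hyp_carrier_inhabited t : inhabited (hyp_carrier t).
Proof.
case: t => [u|j] /=; first exact: carrier_inhabited.
have [x] := carrier_inhabited M tt.
by constructor; exists [set b' | Erel (fun=> x) b']; exists (fun=> x).
Qed.

Definition hyp_rint (R : hyp_rsym) (a : env M (real 'I_(hr_real R)))
    (c : forall k : 'I_(hr_num R), Eclass (hr_type k)) : Prop :=
  exists b : forall k : 'I_(hr_num R), env M (real (len (hr_type k))),
    (forall k, sval (c k) (b k)) /\
    sat (hr_formula R) (sum_env a (fun p => b (tag p) (tagged p))).

Definition hyp_structure : structure hyp_signature :=
  @Structure _ hyp_signature hyp_carrier hyp_carrier_inhabited
    (fun f a => @fint _ _ M f a)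
    (fun r => match r return
         (forall i : rarity hyp_signature r, hyp_carrier (@rdom _ hyp_signature r i)) -> Prop
       with
       | inl r => fun a => @rint _ _ M r a
       | inr R => fun a => hyp_rint (fun i => a (inl i)) (fun k => a (inr k))
       end).

Definition hyp_theory : theory hyp_signature :=
  [set chi | holds hyp_structure chi].

End Hyperimaginaries.
Arguments real I i : clear implicits.
Arguments Erel {L} M {J len} E j b b'.
Arguments hyp_structure {L} M {J len} E.
Arguments hyp_theory {L} M {J len} E _.

(* Main.v *)
Require Import Defs.
From Corelib Require RelationClasses.
From mathcomp Require Import all_boot.
From mathcomp Require Import boolp classical_sets functions cardinality.

(* A translation carries SOP_1 from T to its hyperimaginary extension.

   For the converse, replace every hyperimaginary by a representative, an
   infinite real tuple.  By saturation, a formula of the extension becomes a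
   partial type in the representatives, the set of all its consequences:
   existential quantification over a hyperimaginary, or over the
   representatives in R_phi, is quantification over an infinite tuple, which
   commutes with intersections of definable sets.  If phi, psi witness SOP_1,
   then psi(y1, y2), phi(x, y1) and phi(x, y2) become three partial types that
   are jointly inconsistent, so by compactness L-formulas phi0, psi0 implied by
   them already clash in M, and the same tree, read in representatives, shows
   that phi0 has SOP_1.  JEP and existential closedness of M turn inconsistency
   in M into inconsistency in all models of T. *)

Set Implicit Arguments.
Unset Strict Implicit.
Unset Printing Implicit Defensive.

Local Open Scope classical_set_scope.
Local Open Scope card_scope.

(** * Cardinals *)

Definition embeds (A B : Type) : Prop := exists f : A -> B, injective f.

Lemma embeds_trans B A C : embeds A B -> embeds B C -> embeds A C.
Proof. by move=> [f fI] [g gI]; exists (g \o f); apply: inj_comp. Qed.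

Lemma sval_injective T (P : T -> Prop) : injective (@sval T P).
Proof. by move=> x y /eq_sig_hprop; apply=> *; apply: Prop_irrelevance. Qed.

Lemma card_le_embeds (T U : Type) (A : set T) (B : set U) :
  A #<= B <-> exists f : {x | A x} -> {y | B y}, injective f.
Proof.
split.
  move=> /card_leP/injfunPex[f _ fI].
  pose g (x : {x | A x}) : {y | B y} :=
    exist _ _ (set_valP (f (SigSub (mem_set (svalP x))))).
  exists g => x y /(congr1 sval) /= /val_inj /fI.
  by rewrite !in_setT => /(_ isT isT)/(congr1 val) /= /sval_injective.
move=> [f fI]; apply/card_leP/injfunPex.
exists (fun x : A => SigSub (mem_set (svalP (f (exist _ _ (set_valP x)))))) => //.
move=> x y _ _ /(congr1 val) /= /sval_injective/fI e; apply: val_inj.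
exact: (congr1 sval e).
Qed.

Lemma card_leT_embeds A B : [set: A] #<= [set: B] <-> embeds A B.
Proof.
rewrite card_le_embeds; split=> -[f fI].
  exists (fun x => sval (f (exist _ x I))) => x y /sval_injective/fI e.
  exact: (congr1 sval e).
exists (fun x => exist _ (f (sval x)) I) => x y /(congr1 sval) /= /fI.
exact: sval_injective.
Qed.

(** Comparability of cardinals by Zorn's lemma: a maximal partial bijection between [A] and [B] is
    defined on all of [A] or reaches all of [B]. *)
Lemma embeds_total A B : embeds A B \/ embeds B A.
Proof.
pose P (R : set (A * B)) :=
  forall p q, R p -> R q -> (p.1 = q.1 <-> p.2 = q.2).
have [|R [PR Rmax]] := @Zorn_bigcup _ P.
  move=> F FP Ftot p q [X FX Xp] [Y FY Yq].
  have [XY|YX] := Ftot X Y FX FY.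
    by apply: (FP Y) => //; apply: XY.
  by apply: (FP X) => //; apply: YX.
have [[a Ra]|dom] := pselect (exists a, forall b, ~ R (a, b)); last first.
  have {}dom a : exists b, R (a, b).
    by apply: contrapT => Na; apply: dom; exists a => b Rab; apply: Na; exists b.
  left; exists (fun a => sval (cid (dom a))) => x y.
  case: cid => u Ru; case: cid => v Rv /= uv.
  exact/(PR _ _ Ru Rv).
have [[b Rb]|ran] := pselect (exists b, forall a, ~ R (a, b)); last first.
  have {}ran b : exists a, R (a, b).
    by apply: contrapT => Na; apply: ran; exists b => x Rxb; apply: Na; exists x.
  right; exists (fun b => sval (cid (ran b))) => x y.
  case: cid => u Ru; case: cid => v Rv /= uv.
  exact/(PR _ _ Ru Rv).
(* With [a] outside the domain and [b] outside the range, the pair [(a, b)] would enlarge the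
   maximal [R]. *)
case: (Rmax (R `|` [set (a, b)])).
  split=> [p Rp|/(_ (a, b)) h]; first by left.
  by apply: (Ra b); apply: h; right.
move=> p q [Rp|->] [Rq|->] //=; first exact: PR.
  by split=> e; [case: (Ra p.2) | case: (Rb p.1)]; rewrite -e -surjective_pairing.
by split=> e; [case: (Ra q.2) | case: (Rb q.1)]; rewrite e -surjective_pairing.
Qed.

(** [{classic T}] equips [T] with a classical equality test; the absence of repetitions later gives
    an injective enumeration. *)
Lemma finite_set_list T (D : set T) : finite_set D ->
  exists l : seq {classic T}, uniq l /\ D = [set` l].
Proof.
move=> /(@finite_seqP {classic T})[l Dl]; exists (undup l).
split; first exact: undup_uniq.
by rewrite Dl; apply/seteqP; split=> x /=; rewrite mem_undup.
Qed.

(* A maximal family of disjoint copies of nat covers B up to a finite set. *)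
Lemma embeds_double B : embeds nat B -> embeds (B * bool) B.
Proof.
move=> natB.
pose P (F : set (nat -> B)) := forall f g, F f -> F g ->
  forall m n, f m = g n -> f = g /\ m = n.
have [|F [PF Fmax]] := @Zorn_bigcup _ P.
  move=> F FP Ftot f g [X FX Xf] [Y FY Yg].
  have [XY|YX] := Ftot X Y FX FY.
    by apply: (FP Y) => //; apply: XY.
  by apply: (FP X) => //; apply: YX.
pose D := [set x | forall f, F f -> forall n, f n <> x].
(* An infinite leftover [D] would contain one more copy of [nat], against maximality. *)
have finD : finite_set D.
  apply: contrapT => /infiniteP/card_le_embeds[g gI].
  pose h n := sval (g (exist _ n I)).
  have hI : injective h.
    by move=> m n /sval_injective/gI e; apply: (congr1 sval e).
  have hD n : D (h n) by exact: svalP.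
  case: (Fmax (F `|` [set h])).
    split=> [f Ff|/(_ h) k]; first by left.
    by apply: (hD 0%N h _ 0%N) => //; apply: k; right.
  move=> f1 f2 [F1|->] [F2|->] m n; first exact: PF.
  - by move/hD.
  - by move/esym/hD.
  - by move/hI.
(* [F] is nonempty, for otherwise [D] would be all of [B], which is infinite. *)
have [f0 Ff0] : exists f0, F f0.
  apply: contrapT => nF; case: natB => g gI.
  suff: infinite_set D by [].
  apply/infiniteP/card_le_embeds.
  have gD n : D (g n) by move=> f Ff; case: nF; exists f.
  exists (fun n => exist _ (g (sval n)) (gD (sval n))) => x y.
  move=> /(congr1 sval) /= /gI.
  exact: sval_injective.
have [l [_ Dl]] := finite_set_list finD.
(* Flag true: [x] is an entry of a sequence of [F]. Flag false: [x] is a leftover point, recorded by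
   its position in [l] next to some sequence of [F]. *)
pose code x (p : (nat -> B) * nat * bool) := F p.1.1 /\
  (if p.2 then p.1.1 p.1.2 = x else D x /\ p.1.2 = index (x : {classic B}) l).
have ex_code x : exists p, code x p.
  have [Dx|] := pselect (D x); first by exists (f0, index (x : {classic B}) l, false).
  move=> /existsNP[f /not_implyP[Ff /existsNP[n /contrapT fn]]].
  by exists (f, n, true).
pose k x := sval (cid (ex_code x)).
have kP x : code x (k x) by rewrite /k; case: cid.
have bitI n m (b c : bool) : (b + n.*2 = c + m.*2)%N -> n = m /\ b = c.
  move=> e; split.
    by move: (congr1 half e); rewrite !half_bit_double.
  by move: (congr1 odd e); rewrite !oddD !odd_double !addbF !oddb.
(* For flag u, bit b and index n, the pair goes to entry u + 2b + 4n of the sequence: the residue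
   modulo 4 separates the two copies of [B] and keeps leftover points apart from the others. *)
exists (fun xb : B * bool => (k xb.1).1.1 ((k xb.1).2 + (xb.2 + (k xb.1).1.2.*2).*2)%N).
move=> [x b] [y c] /=; move: (kP x) (kP y).
case: (k x) (k y) => [[f m] u] [[g n] v]; rewrite /code /= => -[Ff xP] [Fg yP].
move=> /(PF _ _ Ff Fg)[fg /bitI[/bitI[mn bc] uv]].
congr (_, _); last by [].
subst; case: v xP yP => [-> //|[Dx ->] [Dy ixy]].
rewrite Dl /= in Dx Dy.
by rewrite -(nth_index (x : {classic B}) Dx) -(nth_index (x : {classic B}) Dy) ixy.
Qed.

Lemma embeds_sum_double A B C : embeds A C -> embeds B C ->
  embeds (A + B) (C * bool).
Proof.
move=> [f fI] [g gI].
exists (fun u => match u with inl a => (f a, true) | inr b => (g b, false) end).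
by move=> [a|b] [a'|b'] // [] => [/fI|/gI] ->.
Qed.

Lemma smallP K A : small K A <-> embeds A K /\ ~ embeds K A.
Proof.
rewrite /small; split=> [/andP[/card_leT_embeds AK KA]|[AK KA]].
  by split=> // /card_leT_embeds; apply/negP.
by apply/andP; split; [apply/card_leT_embeds|apply/negP => /card_leT_embeds].
Qed.

Lemma small_embeds K A B : embeds A B -> small K B -> small K A.
Proof.
move=> AB /smallP[BK KB]; apply/smallP; split; first exact: embeds_trans BK.
by move=> KA; apply: KB; apply: embeds_trans AB.
Qed.

(** [K] is infinite because [nat] is small, so it absorbs its double and contains the sum. If [K]
    embedded in the sum, it would embed in the double of the larger summand. *)
Lemma small_sum K A B : small K nat ->
  small K A -> small K B -> small K (A + B).
Proof.
move=> /smallP[natK Knat] sA sB.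
have small_double C : small K C -> ~ embeds K (C * bool).
  (* If [nat] embeds in [C], then [C] absorbs its double; if [C] embeds in [nat], its double is
     still countable, and [K] is not. *)
  move=> /smallP[_ KC] KCC; case: (embeds_total nat C) => [natC|Cnat].
    by apply/KC/(embeds_trans KCC)/embeds_double.
  apply: Knat; apply: (embeds_trans KCC).
  apply: (@embeds_trans (nat * bool)); last by apply: embeds_double; exists id.
  by case: Cnat => f fI; exists (fun p => (f p.1, p.2)) => -[x b] [y c] [/fI -> ->].
apply/smallP; split.
  move: sA sB => /smallP[AK _] /smallP[BK _].
  by apply/(embeds_trans (embeds_sum_double AK BK))/embeds_double.
move=> KAB; case: (embeds_total A B) => [AB|BA].
  apply: (small_double B) => //; apply: (embeds_trans KAB).
  by apply: embeds_sum_double => //; exists id.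
apply: (small_double A) => //; apply: (embeds_trans KAB).
by apply: embeds_sum_double => //; exists id.
Qed.

(** Induction on [n], splitting off the fibre over [ord0]. *)
Lemma small_tag_ord K n (P : 'I_n -> Type) : small K nat ->
  (forall i, small K (P i)) -> small K {i : 'I_n & P i}.
Proof.
move=> natK; elim: n P => [|n IH] P sP.
  by apply: small_embeds natK; exists (fun x => tag x) => -[[]].
apply: (@small_embeds _ _ (P ord0 + {i : 'I_n & P (lift ord0 i)})); last first.
  by apply: small_sum => //; apply: IH.
pose f (u : P ord0 + {i : 'I_n & P (lift ord0 i)}) : {i : 'I_n.+1 & P i} :=
  match u with
  | inl p => existT _ ord0 p
  | inr q => existT P (lift ord0 (tag q)) (tagged q)
  end.
have fS x : exists u, f u = x.
  case: x => i p; case: (unliftP ord0 i) p => [j ->|->] p.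
    by exists (inr (existT _ j p)).
  by exists (inl p).
(* A choice of preimages under the surjection [f] is injective. *)
exists (fun x => sval (cid (fS x))) => x y e.
by rewrite -(svalP (cid (fS x))) e (svalP (cid (fS y))).
Qed.

(** * Substitution *)

Section Substitution.
Context {S : Type} {L : signature S}.

Fixpoint term_subst {V V' : Type} {s : V -> S} {s' : V' -> S}
    (f : forall v, term L s' (s v)) {t : S} (u : term L s t) : term L s' t :=
  match u with
  | Var v => f v
  | App g args => App (fun i => term_subst f (args i))
  end.

Definition subst_up {V V' : Type} {s : V -> S} {s' : V' -> S} {t : S}
    (f : forall v, term L s' (s v)) (u : option V) :
    term L (ext_sort s' t) (ext_sort s t u) :=
  match u with
  | Some v => term_subst (fun v => @Var _ L _ (ext_sort s' t) (Some v)) (f v)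
  | None => @Var _ L _ (ext_sort s' t) None
  end.

Fixpoint subst {V V' : Type} {s : V -> S} {s' : V' -> S}
    (f : forall v, term L s' (s v)) (phi : formula L s) : formula L s' :=
  match phi with
  | Rel r args => Rel (fun i => term_subst f (args i))
  | Eq t t1 t2 => Eq (term_subst f t1) (term_subst f t2)
  | Top => Top _ _
  | Bot => Bot _ _
  | And phi psi => And (subst f phi) (subst f psi)
  | Or phi psi => Or (subst f phi) (subst f psi)
  | Ex t phi => Ex (subst (subst_up f) phi)
  end.

Lemma eval_subst (M : structure L) V V' (s : V -> S) (s' : V' -> S)
    (f : forall v, term L s' (s v)) t (u : term L s t) (a : env M s') :
  eval a (term_subst f u) = eval (fun v => eval a (f v)) u.
Proof. by elim: u => //= g args IH; congr fint; apply: functional_extensionality_dep. Qed.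

Lemma sat_subst (M : structure L) V V' (s : V -> S) (s' : V' -> S)
    (f : forall v, term L s' (s v)) (phi : formula L s) (a : env M s') :
  sat (subst f phi) a <-> sat phi (fun v => eval a (f v)).
Proof.
elim: phi V' s' f a => {V s} [V s r args|V s t t1 t2|V s|V s|V s p IHp q IHq
  |V s p IHp q IHq|V s t p IHp] V' s' f a //=.
- have -> // : (fun i => eval a (term_subst f (args i))) =
               (fun i => eval (fun v => eval a (f v)) (args i)).
  by apply: functional_extensionality_dep => i; rewrite eval_subst.
- by rewrite !eval_subst.
- by rewrite IHp IHq.
- by rewrite IHp IHq.
- have E x : (fun v => eval (ext_env a x) (subst_up f v)) =
      ext_env (fun v => eval a (f v)) x.
    apply: functional_extensionality_dep => -[v|] //=.
    by rewrite eval_subst.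
  by split=> -[x]; [rewrite IHp E|rewrite -E -IHp] => ?; exists x.
Qed.

Fixpoint term_vars {V : Type} {s : V -> S} {t : S} (u : term L s t) : set V :=
  match u with
  | Var v => [set v]
  | App f args => [set v | exists i, term_vars (args i) v]
  end.

Fixpoint vars {V : Type} {s : V -> S} (phi : formula L s) : set V :=
  match phi with
  | Rel r args => [set v | exists i, term_vars (args i) v]
  | Eq t t1 t2 => term_vars t1 `|` term_vars t2
  | Top => set0
  | Bot => set0
  | And phi psi => vars phi `|` vars psi
  | Or phi psi => vars phi `|` vars psi
  | Ex t phi => Some @^-1` vars phi
  end.

Lemma finite_ex_fin (F : finType) V (D : F -> set V) :
  (forall i, finite_set (D i)) -> finite_set [set v | exists i, D i v].
Proof.
move=> fD; have -> : [set v | exists i, D i v] = \bigcup_(i in [set: F]) D i.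
  by apply/seteqP; split=> v [i]; [exists i | move=> _; exists i].
by apply: bigcup_finite => // i _; apply: fD.
Qed.

Lemma finite_term_vars V (s : V -> S) t (u : term L s t) :
  finite_set (term_vars u).
Proof. by elim: u => [v|f args IH] /=; [exact: finite_set1|exact: finite_ex_fin]. Qed.

Lemma finite_vars V (s : V -> S) (phi : formula L s) : finite_set (vars phi).
Proof.
elim: phi => {V s} [V s r args|V s t t1 t2|V s|V s|V s p IHp q IHq
  |V s p IHp q IHq|V s t p IHp] /=; rewrite ?finite_setU //.
- by apply: finite_ex_fin => i; apply: finite_term_vars.
- by split; apply: finite_term_vars.
- by apply: finite_preimage IHp => x y _ _ [].
Qed.

(** Support is taken semantically, so that it also makes sense for formulas known only through their
    truth conditions, such as those produced by [ex_vars]. *)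
Definition supported {V : Type} {s : V -> S} (D : set V) (phi : formula L s) :
    Prop :=
  forall (M : structure L) (a b : env M s), (forall v, D v -> a v = b v) ->
  sat phi a -> sat phi b.

Lemma eval_term_vars (M : structure L) V (s : V -> S) t (u : term L s t)
  (a b : env M s) : (forall v, term_vars u v -> a v = b v) -> eval a u = eval b u.
Proof.
elim: u => [v|f args IH] /= ab; first exact: ab.
by congr fint; apply: functional_extensionality_dep => i; apply: IH => v uv;
  apply: ab; exists i.
Qed.

Lemma supported_vars V (s : V -> S) (phi : formula L s) :
  supported (vars phi) phi.
Proof.
move=> M; elim: phi => {V s} [V s r args|V s t t1 t2|V s|V s|V s p IHp q IHq
  |V s p IHp q IHq|V s t p IHp] a b /= ab //.
- have -> // : (fun i => eval a (args i)) = (fun i => eval b (args i)).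
  apply: functional_extensionality_dep => i.
  by apply: eval_term_vars => v uv; apply: ab; exists i.
- rewrite (@eval_term_vars _ _ _ _ t1 a b) ?(@eval_term_vars _ _ _ _ t2 a b) //.
    by move=> v uv; apply: ab; right.
  by move=> v uv; apply: ab; left.
- by move=> [pa qa]; split; [apply: IHp pa|apply: IHq qa] => v pv; apply: ab;
    [left|right].
- by move=> [pa|qa]; [left; apply: IHp pa|right; apply: IHq qa] => v pv;
    apply: ab; [left|right].
- move=> [x px]; exists x; apply: IHp px => -[v|] //= pv; exact: ab.
Qed.

(** Positive formulas contain no negation, so every case of the induction goes in one direction. *)
Lemma sat_hom (M N : structure L) (h : forall t, M t -> N t) :
  homomorphism h -> forall V (s : V -> S) (phi : formula L s) (a : env M s),
  sat phi a -> sat phi (fun v => h _ (a v)).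
Proof.
move=> [hf hr].
have ev V (s : V -> S) t (u : term L s t) (a : env M s) :
    eval (fun v => h _ (a v)) u = h _ (eval a u).
  elim: u => //= f args IH; rewrite hf; congr fint.
  exact: functional_extensionality_dep.
move=> V s; elim=> {V s} [V s r args|V s t t1 t2|V s|V s|V s p IHp q IHq
  |V s p IHp q IHq|V s t p IHp] a //=.
- move=> /hr; set x := fun i => _; set y := fun i => _.
  have -> // : x = y by apply: functional_extensionality_dep => i; rewrite /x /y ev.
- by rewrite !ev => ->.
- by move=> [/IHp ? /IHq].
- by move=> [/IHp ?|/IHq]; [left|right].
- move=> [x /IHp px]; exists (h _ x).
  have <- // : (fun v => h _ (ext_env a x v)) = ext_env (fun v => h _ (a v)) (h _ x).
  by apply: functional_extensionality_dep => -[].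
Qed.

Lemma sum_env_eta (M : structure L) V W (s : V -> S) (t : W -> S)
    (e : env M (sum_sort s t)) :
  sum_env (fun v => e (inl v)) (fun w => e (inr w)) = e.
Proof. by apply: functional_extensionality_dep => -[]. Qed.

Definition subst_sum {V W V' : Type} {s : V -> S} {t : W -> S} {s' : V' -> S}
    (f : forall v, term L s' (s v)) (g : forall w, term L s' (t w)) (u : V + W) :
    term L s' (sum_sort s t u) :=
  match u with inl v => f v | inr w => g w end.

Lemma sat_subst_sum (M : structure L) V W V' (s : V -> S) (t : W -> S)
    (s' : V' -> S) (f : forall v, term L s' (s v)) (g : forall w, term L s' (t w))
    (phi : formula L (sum_sort s t)) (a : env M s') :
  sat (subst (subst_sum f g) phi) a <->
  sat phi (sum_env (fun v => eval a (f v)) (fun w => eval a (g w))).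
Proof.
rewrite sat_subst.
have -> // : (fun u => eval a (subst_sum f g u)) =
    sum_env (fun v => eval a (f v)) (fun w => eval a (g w)).
by apply: functional_extensionality_dep => -[].
Qed.

Definition bigAnd {V : Type} {s : V -> S} (l : seq (formula L s)) : formula L s :=
  foldr (@And _ L V s) (Top _ _) l.

Lemma sat_bigAnd (M : structure L) V (s : V -> S)
    (l : seq {classic formula L s}) (a : env M s) :
  sat (bigAnd l) a <-> forall phi, phi \in l -> sat phi a.
Proof.
elim: l => [|p l IH] //=; rewrite IH; split=> [[pa la] q|la].
  by rewrite in_cons => /orP[/eqP ->|/la].
split=> [|q ql]; apply: la; rewrite in_cons ?eqxx ?ql ?orbT //.
Qed.

Lemma env_inhabited (M : structure L) V (s : V -> S) : inhabited (env M s).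
Proof.
constructor=> v; case: (cid (_ : exists x : M (s v), True)) => //.
by case: (carrier_inhabited M (s v)) => x; exists x.
Qed.

End Substitution.

(** * Finite supports and quantifiers over infinite tuples *)

(** A variable sort [u : unit] is not convertible to [tt]; this match transports along the provable
    equality. *)
Definition of_tt {P : unit -> Type} {u : unit} (x : P tt) : P u :=
  match u with tt => x end.

Section SingleSorted.
Context {L : signature unit}.

Lemma eval_of_tt (M : structure L) V (s : V -> unit) (a : env M s) u
    (x : term L s tt) : eval a (of_tt x : term L s u) = of_tt (eval a x).
Proof. by case: u. Qed.

Lemma of_tt_surj (P : unit -> Type) u (y : P u) : exists x : P tt, of_tt x = y.
Proof. by case: u y => y; exists y. Qed.

(* The variables outside the range of f, which do not matter, are replaced by
   one dummy bound variable. *)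
Lemma restrict_vars V V' (s : V -> unit) (f : V' -> V) (phi : formula L s) :
  supported (range f) phi ->
  exists phi' : formula L (fun v' => s (f v')),
    forall (M : structure L) (a : env M s),
    sat phi' (fun v' => a (f v')) <-> sat phi a.
Proof.
move=> fphi.
have g v : {u : term L (ext_sort (fun v' => s (f v')) tt) (s v) |
    forall (M : structure L) (a : env M s) x, range f v ->
    eval (ext_env (fun v' => a (f v')) x) u = a v}.
  have [/cid[v' e]|nf] := pselect (exists v', f v' = v).
    by case: v / e; exists (@Var _ L _ (ext_sort (fun v' => s (f v')) tt) (Some v')).
  exists (of_tt (@Var _ L _ (ext_sort (fun v' => s (f v')) tt) None)).
  by move=> M a x [v' _ e]; case: nf; exists v'.
exists (@Ex _ _ _ (fun v' => s (f v')) tt (subst (fun v => sval (g v)) phi)) => M a.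
split=> /= [[x]|pa].
  by rewrite sat_subst; apply: fphi => v fv; apply: (svalP (g v)).
(* The dummy quantifier is harmless because carriers are inhabited. *)
have [x] := carrier_inhabited M tt; exists x; rewrite sat_subst.
by apply: fphi pa => v fv; rewrite (svalP (g v)).
Qed.

Lemma restrict_sum_vars V V' W W' (s : V -> unit) (t : W -> unit)
    (f : V' -> V) (g : W' -> W) (phi : formula L (sum_sort s t)) :
  inl @^-1` vars phi `<=` range f -> inr @^-1` vars phi `<=` range g ->
  exists phi' : formula L (sum_sort (fun v' => s (f v')) (fun w' => t (g w'))),
    forall (M : structure L) (a : env M s) (b : env M t),
    sat phi' (sum_env (fun v' => a (f v')) (fun w' => b (g w'))) <->
    sat phi (sum_env a b).
Proof.
move=> fphi gphi.
pose h (u : V' + W') := match u with inl v => inl (f v) | inr w => inr (g w) end.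
have [|phi' phi'P] := @restrict_vars _ _ _ h phi.
  move=> M a b ab; apply: supported_vars => u pu; apply: ab; move: u pu.
  by move=> [v /fphi[v' _ <-]|w /gphi[w' _ <-]]; [exists (inl v')|exists (inr w')].
(* The sort map of [phi'] agrees with [s'] only pointwise; the substitution [k] is the identity on
   variables and performs the change of context. *)
pose s' := sum_sort (fun v' => s (f v')) (fun w' => t (g w')).
pose k u : term L s' (sum_sort s t (h u)) :=
  match u with inl v' => @Var _ L _ s' (inl v') | inr w' => @Var _ L _ s' (inr w') end.
exists (subst k phi') => M a b; rewrite sat_subst -phi'P.
set e1 := (X in sat phi' X); set e2 := (X in _ <-> sat phi' X).
have -> // : e1 = e2 by apply: functional_extensionality_dep => -[].
Qed.

Lemma ex_vars V (s : V -> unit) (phi : formula L s) (l : seq {classic V}) :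
  exists phi' : formula L s, forall (M : structure L) (a : env M s),
  sat phi' a <->
  exists b : env M s, (forall v : {classic V}, v \notin l -> b v = a v) /\ sat phi b.
Proof.
elim: l => [|u l [phi1 IH]].
  exists phi => M a; split=> [pa|[b [ba pb]]]; first by exists a.
  have -> // : a = b by apply: functional_extensionality_dep => v; rewrite ba.
pose f v : term L (ext_sort s tt) (s v) :=
  if (v : {classic V}) == u then of_tt (@Var _ L _ (ext_sort s tt) None)
  else @Var _ L _ (ext_sort s tt) (Some v).
exists (@Ex _ _ _ s tt (subst f phi1)) => M a.
have fE x v : eval (ext_env a x) (f v) =
    if (v : {classic V}) == u then of_tt x else a v.
  by rewrite /f; case: eqP => // _; rewrite eval_of_tt.
split=> [/= [x]|[b [ba pb]] /=].
  rewrite sat_subst IH => -[b [ba pb]]; exists b; split=> // v.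
  by rewrite in_cons negb_or => /andP[vu vl]; rewrite ba // fE (negPf vu).
have [x xb] := of_tt_surj (b u); exists x; rewrite sat_subst IH; exists b; split=> //.
move=> v vl; rewrite fE; case: eqP => [vu|/eqP vu]; last first.
  by rewrite ba // in_cons negb_or vu.
by rewrite vu in vl *.
Qed.

(** A formula mentions finitely many places, so quantifying over an infinite tuple amounts to
    quantifying over those of its places that occur; the others may take any value. *)
Lemma ex_tuple V W (s : V -> unit) (t : W -> unit)
    (phi : formula L (sum_sort s t)) :
  exists phi' : formula L t, forall (M : structure L) (b : env M t),
  sat phi' b <-> exists c : env M s, sat phi (sum_env c b).
Proof.
have [l [_ lE]] : exists l : seq {classic V + W}, uniq l /\
    vars phi `&` range inl = [set` l].
  by apply/finite_set_list/finite_setIl/finite_vars.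
have lP u : u \in l <-> vars phi u /\ range inl u.
  have lu : (vars phi `&` range inl) u = (u \in l) by rewrite lE.
  by rewrite -lu.
(* The patched environment follows [b] on [l] and [c] elsewhere. A variable of [phi] outside [l] is
   a free place, where [a] and [c] agree. *)
have patch (M : structure L) (a b c : env M (sum_sort s t)) :
    (forall u : {classic V + W}, u \notin l -> b u = a u) -> sat phi b ->
    (forall w, a (inr w) = c (inr w)) ->
    exists b' : env M (sum_sort s t),
      (forall u : {classic V + W}, u \notin l -> b' u = c u) /\ sat phi b'.
  move=> ba pb ac.
  exists (fun u => if (u : {classic V + W}) \in l then b u else c u).
  split=> [u /negPf -> //|]; apply: supported_vars pb => u pu.
  case: ifP => // /negP ul; rewrite ba; last exact/negP.
  case: u pu ul => [v pv ul|//]; case: ul.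
  by apply/lP; split=> //; exists v.
have [phi1 phi1P] := ex_vars phi l.
(* The truth of [phi1] no longer depends on the quantified tuple, so its context can be cut down to
   [t]. *)
have [|phi2 phi2P] := @restrict_vars _ _ _ inr phi1.
  move=> M a b ab; rewrite !phi1P => -[c [ca pc]].
  by apply: patch ca pc _ => w; apply: ab; exists w.
exists phi2 => M b.
have [c0] := env_inhabited M s.
rewrite -[b]/(fun w => sum_env c0 b (inr w)) phi2P phi1P.
split=> [[a [ab pa]]|[c pc]].
  exists (fun v => a (inl v)); rewrite -[X in sat phi X](sum_env_eta a) in pa.
  have -> // : b = (fun w => a (inr w)).
  apply: functional_extensionality_dep => w; rewrite ab //.
  by apply/negP => /lP[_ [v _]].
by apply: patch pc _.
Qed.

End SingleSorted.

(** * Type-definable sets *)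

Section TypeDefinable.
Context {L : signature unit} (M : structure L).

(* P is the set of realisations of a partial type over the empty set, namely of
   the type of all its consequences. *)
Definition type_definable {V : Type} {s : V -> unit} (P : env M s -> Prop) : Prop :=
  forall a, (forall phi : formula L s, (forall b, P b -> sat phi b) -> sat phi a) ->
  P a.

Lemma type_definable_ext V (s : V -> unit) (P Q : env M s -> Prop) :
  (forall a, P a <-> Q a) -> type_definable P -> type_definable Q.
Proof.
by move=> PQ cP a Qa; apply/PQ/cP => phi Pphi; apply: Qa => b /PQ/Pphi.
Qed.

Lemma type_definable_sat V (s : V -> unit) (phi : formula L s) :
  type_definable (fun a : env M s => sat phi a).
Proof. by move=> a; apply. Qed.

Lemma type_definable_forall V (s : V -> unit) I (P : I -> env M s -> Prop) :
  (forall i, type_definable (P i)) -> type_definable (fun a => forall i, P i a).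
Proof. by move=> cP a Pa i; apply: cP => phi Pphi; apply: Pa => b /(_ i)/Pphi. Qed.

Lemma type_definable_and V (s : V -> unit) (P Q : env M s -> Prop) :
  type_definable P -> type_definable Q -> type_definable (fun a => P a /\ Q a).
Proof.
by move=> cP cQ a PQa; split; [apply: cP|apply: cQ] => phi H; apply: PQa => b [Pb Qb];
  apply: H.
Qed.

(** If [a] lies in neither set, it violates some consequence of [P] and some consequence of [Q],
    hence their disjunction. *)
Lemma type_definable_or V (s : V -> unit) (P Q : env M s -> Prop) :
  type_definable P -> type_definable Q -> type_definable (fun a => P a \/ Q a).
Proof.
move=> cP cQ a PQa; apply: contrapT => /not_orP[nP nQ].
apply: nP; apply: cP => phi Pphi; apply: contrapT => nphi.
apply: nQ; apply: cQ => psi Qpsi; apply: contrapT => npsi.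
suff: sat (Or phi psi) a by case.
by apply: PQa => b [/Pphi|/Qpsi]; [left|right].
Qed.

Lemma type_definable_subst V W (s : V -> unit) (t : W -> unit)
    (f : forall v, term L t (s v)) (P : env M s -> Prop) :
  type_definable P -> type_definable (fun a : env M t => P (fun v => eval a (f v))).
Proof.
move=> cP a Pa; apply: cP => phi Pphi; rewrite -sat_subst.
by apply: Pa => b /Pphi; rewrite sat_subst.
Qed.

(** By saturation: if [b] satisfies all consequences of the projection, the consequences of [P] with
    [b] plugged in are finitely satisfiable, hence realised. *)
Lemma type_definable_ex K T V W (s : V -> unit) (t : W -> unit)
    (P : env M (sum_sort s t) -> Prop) :
  monster K T M -> small K V -> small K W ->
  type_definable P ->
  type_definable (fun b : env M t => exists c : env M s, P (sum_env c b)).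
Proof.
move=> mM sV sW cP b Pb.
have [|c Pc] := @monster_saturated _ _ _ _ _ mM V W s t b sV sW
    [set phi | forall e, P e -> sat phi e]; last by exists c; apply: cP.
move=> Delta /finite_set_list[l [_ ->]] lP.
(* The formula saying that some tuple realises the finite part [l] is itself a consequence of the
   projection, so it holds at [b]. *)
have [psi psiP] := ex_tuple (bigAnd l).
have /psiP[c] : sat psi b.
  apply: Pb => b' [c Pc]; apply/psiP; exists c; apply/sat_bigAnd => phi /lP.
  exact.
by move=> /sat_bigAnd lc; exists c => phi /lc.
Qed.

End TypeDefinable.
Arguments type_definable_sat {L M V s} phi.

(** * Hyperimaginaries as classes of real tuples *)

Section Representatives.
Context {L : signature unit} (M : structure L) {J : Type} {len : J -> Type}
  (E : forall j, set (formula L (sum_sort (real (len j)) (real (len j))))).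

(** A real element counts as a tuple with a single place, so that both kinds of sorts are treated
    alike. *)
Definition place (t : unit + J) : Type :=
  match t with inl _ => unit | inr j => len j end.

Definition place_sort (t : unit + J) : unit :=
  match t with inl u => u | inr _ => tt end.

Definition to_hyp (t : unit + J) :
    (place t -> M (place_sort t)) -> hyp_structure M E t :=
  match t with
  | inl u => fun c => c tt
  | inr j => fun c => exist _ [set b | Erel M E j c b] (ex_intro _ c erefl)
  end.

Lemma to_hyp_surj t (c : hyp_structure M E t) : exists b, to_hyp b = c.
Proof.
case: t c => [u|j] c; first by exists (fun=> c).
by case: c => c [b e]; exists b; apply: sval_injective.
Qed.

(** Function symbols take real values, so a term of hyperimaginary sort is a variable, and [f]
    supplies its tuple of representing terms. *)
Fixpoint real_term {V W : Type} {s : V -> unit + J} {w : W -> unit}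
    (f : forall v, place (s v) -> term L w (place_sort (s v))) {t : unit + J}
    (u : term (hyp_signature L len) s t) : place t -> term L w (place_sort t) :=
  match u in term _ _ t return place t -> term L w (place_sort t) with
  | Var v => f v
  | App g args => fun=> @App _ L _ w g (fun i => real_term f (args i) tt)
  end.

Definition hyp_env {V W : Type} {s : V -> unit + J} {w : W -> unit}
    (f : forall v, place (s v) -> term L w (place_sort (s v))) (a : env M w) :
    env (hyp_structure M E) s :=
  fun v => to_hyp (fun p => eval a (f v p)).

Lemma eval_hyp_env V W (s : V -> unit + J) (w : W -> unit)
    (f : forall v, place (s v) -> term L w (place_sort (s v))) (a : env M w)
    t (u : term (hyp_signature L len) s t) :
  eval (hyp_env f a) u = to_hyp (fun p => eval a (real_term f u p)).
Proof.
elim: u => //= g args IH; congr fint.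
by apply: functional_extensionality_dep => i; rewrite IH.
Qed.

Context (eqE : forall j, RelationClasses.Equivalence (Erel M E j)).

(** This turns an equation between hyperimaginaries into a partial type in representatives. *)
Lemma to_hyp_eq j (b c : place (inr j) -> M tt) :
  to_hyp (t := inr j) b = to_hyp (t := inr j) c <-> Erel M E j b c.
Proof.
have [rE sE tE] := eqE j.
split=> [/(congr1 sval) /= bc|bc].
  by rewrite -[Erel _ _ _ _ _]/([set c' | Erel M E j b c'] c) bc; apply: rE.
apply: sval_injective => /=; apply/seteqP; split=> d /=; apply: tE => //.
exact: sE.
Qed.

Context (K : Type) (T : theory L) (mM : monster K T M)
  (slen : forall j, small K (len j)).

Lemma small_place t : small K (place t).
Proof.
case: t => [u|j]; last exact: slen.
apply: (small_embeds _ (monster_nat mM)).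
by exists (fun=> 0) => -[] [].
Qed.

Lemma type_definable_Erel j :
  type_definable (fun a : env M (sum_sort (real (len j)) (real (len j))) =>
    Erel M E j (fun i => a (inl i)) (fun i => a (inr i))).
Proof.
apply: (@type_definable_ext _ _ _ _
  (fun a => forall phi : {phi | E phi}, sat (sval phi) a)).
  move=> a; split=> [Ha phi Ephi|Ha [phi Ephi]].
    by rewrite sum_env_eta; apply: (Ha (exist _ phi Ephi)).
  by move: (Ha phi Ephi); rewrite sum_env_eta.
by apply: type_definable_forall => phi; apply: type_definable_sat.
Qed.

(** The symbol of a formula asks for representatives that are equivalent to the given ones and
    satisfy the formula: a projection along a tuple that is small, being a finite union of small
    ones. *)
Lemma type_definable_hyp_rint W (w : W -> unit) (R : hyp_rsym L len)
    (x : forall i : 'I_(hr_real R), term L w tt)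
    (y : forall k, len (@hr_type _ _ _ R k) -> term L w tt) :
  small K W ->
  type_definable (fun a : env M w => @hyp_rint L M J len E R (fun i => eval a (x i))
    (fun k => to_hyp (t := inr (hr_type k)) (fun p => eval a (y k p)))).
Proof.
move=> sW.
pose U := {k : 'I_(hr_num R) & len (hr_type k)}.
have sU : small K U by apply: small_tag_ord => //; apply: monster_nat mM.
pose u := sum_sort (real U) w.
pose up t (z : term L w t) : term L u t := term_subst (fun v => @Var _ L _ u (inr v)) z.
have upE t (z : term L w t) (c : env M (real U)) (a : env M w) :
    eval (sum_env c a) (up t z) = eval a z by rewrite eval_subst.
pose fR : forall v, term L u (sum_sort (real 'I_(hr_real R)) (real U) v) :=
  subst_sum (s := real 'I_(hr_real R)) (t := real U)
    (fun i => up tt (x i)) (fun p => @Var _ L _ u (inl p)).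
(* [fE k] pairs the given representative of the class number [k] with the quantified one, for use in
   the equivalence relation. *)
pose fE k : forall v,
    term L u (sum_sort (real (len (hr_type k))) (real (len (hr_type k))) v) :=
  subst_sum (s := real (len (hr_type k))) (t := real (len (hr_type k)))
    (fun i => up tt (y k i)) (fun p => @Var _ L _ u (inl (existT _ k p : U))).
have cP := @type_definable_ex L M K T U W (real U) w
  (fun a => (forall k, Erel M E (hr_type k) (fun i => eval a (fE k (inl i)))
                        (fun i => eval a (fE k (inr i)))) /\
            sat (subst fR (hr_formula R)) a) mM sU sW.
apply: type_definable_ext (cP _) => [a|]; last first.
  apply: type_definable_and; last exact: type_definable_sat.
  apply: type_definable_forall => k.
  exact: (type_definable_subst (f := fE k) (@type_definable_Erel (hr_type k))).
split=> [[c [Ec Rc]]|[b [Eb Rb]]].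
  exists (fun k i => c (existT _ k i)); split=> [k|] /=.
    have := Ec k; rewrite /fE /=.
    have -> // : (fun i => eval (sum_env c a) (up tt (y k i))) = fun i => eval a (y k i).
    by apply: functional_extensionality_dep => i; rewrite upE.
  move: Rc; rewrite /fR sat_subst_sum /=.
  have -> : (fun i => eval (sum_env c a) (up tt (x i))) = fun i => eval a (x i).
    by apply: functional_extensionality_dep => i; rewrite upE.
  by have -> // : (fun p : U => c (existT _ (tag p) (tagged p))) = c
    by apply: functional_extensionality_dep => -[].
exists (fun p => b (tag p) (tagged p)); split=> [k|].
  have := Eb k; rewrite /fE /=.
  have -> // : (fun i => eval (sum_env (fun p : U => b (tag p) (tagged p)) a)
      (up tt (y k i))) = fun i => eval a (y k i).
  by apply: functional_extensionality_dep => i; rewrite upE.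
rewrite /fR sat_subst_sum /=.
by have -> // : (fun i => eval (sum_env (fun p : U => b (tag p) (tagged p)) a)
    (up tt (x i))) = fun i => eval a (x i)
  by apply: functional_extensionality_dep => i; rewrite upE.
Qed.

(** Each connective is matched by a closure property of type-definable sets. The real context [W]
    and the representing terms [f] are general because a quantifier enlarges both. *)
Lemma type_definable_hyp_sat V (s : V -> unit + J) (phi : formula (hyp_signature L len) s)
    W (w : W -> unit)
    (f : forall v, place (s v) -> term L w (place_sort (s v))) :
  small K W -> type_definable (fun a => sat phi (hyp_env f a)).
Proof.
elim: phi W w f => {V s} [V s [r|R] args|V s t t1 t2|V s|V s|V s p IHp q IHq
  |V s p IHp q IHq|V s t p IHp] W w f sW /=.
- apply: type_definable_ext (type_definable_sat
    (@Rel _ L _ w r (fun i => real_term f (args i) tt))).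
  move=> a /=; set e1 := (X in rint X); set e2 := (X in _ <-> rint X).
  have -> // : e1 = e2.
  by apply: functional_extensionality_dep => i; rewrite /e2 eval_hyp_env.
- apply: type_definable_ext (@type_definable_hyp_rint _ w R
    (fun i => real_term f (args (inl i)) tt)
    (fun k => real_term f (args (inr k))) sW) => a /=.
  set e1 := (X in hyp_rint X _); set e2 := (X in _ <-> hyp_rint X _).
  set c1 := (X in hyp_rint _ X); set c2 := (X in _ <-> hyp_rint _ X).
  have -> : e1 = e2.
    by apply: functional_extensionality_dep => i; rewrite /e2 eval_hyp_env.
  have -> // : c1 = c2.
  by apply: functional_extensionality_dep => i; rewrite /c2 eval_hyp_env.
- case: t t1 t2 => [u|j] t1 t2.
    apply: type_definable_ext (type_definable_sat
      (@Eq _ L _ w u (real_term f t1 tt) (real_term f t2 tt))).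
    by move=> a /=; rewrite !eval_hyp_env.
  have := type_definable_subst (f := subst_sum (s := real (len j))
    (t := real (len j)) (real_term f t1) (real_term f t2)) (@type_definable_Erel j).
  by apply: type_definable_ext => a /=; rewrite !eval_hyp_env to_hyp_eq.
- exact: (type_definable_sat (Top L w)).
- exact: (type_definable_sat (Bot L w)).
- by apply: type_definable_and; [apply: IHp|apply: IHq].
- by apply: type_definable_or; [apply: IHp|apply: IHq].
(* Quantification over a class becomes quantification over a fresh tuple of representatives, to
   which [g] sends the bound variable. *)
pose u := sum_sort (fun _ : place t => place_sort t) w.
pose g v : place (ext_sort s t v) -> term L u (place_sort (ext_sort s t v)) :=
  match v with
  | Some v => fun i => term_subst (fun x => @Var _ L _ u (inr x)) (f v i)
  | None => fun i => @Var _ L _ u (inl i)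
  end.
have gE (c : env M (fun _ : place t => place_sort t)) a :
    hyp_env g (sum_env c a) = ext_env (hyp_env f a) (to_hyp c).
  apply: functional_extensionality_dep => -[v|] //=.
  by congr to_hyp; apply: functional_extensionality_dep => i; rewrite eval_subst.
have st := small_place t.
have := type_definable_ex mM st sW (IHp _ u g (small_sum (monster_nat mM) st sW)).
apply: type_definable_ext => a; split=> [[c]|[x]].
  by rewrite gE; exists (to_hyp c).
by have [c <-] := to_hyp_surj x => pc; exists c; rewrite gE.
Qed.

End Representatives.

(** * Inconsistency in all models *)

Section Clash.
Context {S : Type} {L : signature S} {X Y : Type} {sx : X -> S} {sy : Y -> S}.

Let sxyy := sum_sort sx (sum_sort sy sy).

(* psi(y1, y2) /\ phi(x, y1) /\ phi(x, y2) *)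
Definition clash (phi : formula L (sum_sort sx sy))
    (psi : formula L (sum_sort sy sy)) : formula L sxyy :=
  And (subst (subst_sum (fun y => @Var _ L _ sxyy (inr (inl y)))
                        (fun y => @Var _ L _ sxyy (inr (inr y)))) psi)
    (And (subst (subst_sum (fun x => @Var _ L _ sxyy (inl x))
                           (fun y => @Var _ L _ sxyy (inr (inl y)))) phi)
         (subst (subst_sum (fun x => @Var _ L _ sxyy (inl x))
                           (fun y => @Var _ L _ sxyy (inr (inr y)))) phi)).

Lemma sat_clash (M : structure L) phi psi (x : env M sx) (y1 y2 : env M sy) :
  sat (clash phi psi) (sum_env x (sum_env y1 y2)) <->
  [/\ sat psi (sum_env y1 y2), sat phi (sum_env x y1) & sat phi (sum_env x y2)].
Proof. by rewrite /= !sat_subst_sum; split=> [[? []]|[]]. Qed.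

(** Clause (ii) of SOP_1 becomes the inconsistency of one formula, a form that can be carried from
    model to model. *)
Lemma unsat_clash (M : structure L) phi psi :
  (forall (x : env M sx) (y1 y2 : env M sy),
     ~ (sat psi (sum_env y1 y2) /\
        (sat phi (sum_env x y1) /\ sat phi (sum_env x y2)))) <->
  forall a : env M sxyy, ~ sat (clash phi psi) a.
Proof.
split=> [H a|H x y1 y2 [? []] *]; last by apply: H; apply/sat_clash; split; eassumption.
rewrite -(sum_env_eta a) -(sum_env_eta (fun u => a (inr u))).
by move=> /sat_clash[psi12 phi1 phi2]; apply: H (conj psi12 (conj phi1 phi2)).
Qed.

End Clash.

(** The implication from [phi] to [Bot] is an h-inductive sentence true in [M0], hence in [M]. *)
Lemma unsat_model (S : Type) (L : signature S) (M0 M : structure L) (V : finType)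
    (s : V -> S) (phi : formula L s) :
  is_model [set chi | holds M0 chi] M ->
  (forall a : env M0 s, ~ sat phi a) -> forall a : env M s, ~ sat phi a.
Proof.
move=> MM0 phi0 a.
(* Sentences quantify over ordinals, so each [v] is replaced by the variable numbered by its rank,
   its sort being transported along [enum_rankK]. *)
have g v : {u : term L (fun i : 'I_#|V| => s (enum_val i)) (s v) |
    forall b : env M s, eval (fun i => b (enum_val i)) u = b v}.
  move: (enum_rank v) (enum_rankK v) => i e; case: v / e.
  by exists (@Var _ L _ (fun i : 'I_#|V| => s (enum_val i)) i).
pose chi := HSentence (subst (fun v => sval (g v)) phi) (Bot L _).
have /MM0/(_ (fun i => a (enum_val i))) : holds M0 chi.
  by move=> b /sat_subst/phi0.
rewrite /= sat_subst => H pa; apply: H.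
suff -> : (fun v => eval (fun i => a (enum_val i)) (sval (g v))) = a by [].
by apply: functional_extensionality_dep => v; rewrite (svalP (g v)).
Qed.

(** A realisation in [N] persists in a joint extension of [N] and [M]. Since [M] is existentially
    closed, it is immersed there, and the existential closure of [phi] descends to [M]. *)
Lemma unsat_JEP (L : signature unit) (T : theory L) (M N : structure L) V
    (s : V -> unit) (phi : formula L s) :
  JEP T -> existentially_closed T M -> is_model T N ->
  (forall a : env M s, ~ sat phi a) -> forall a : env N s, ~ sat phi a.
Proof.
move=> jep [MT ec] NT Mphi a Na.
have [N' [h1 [h2 [N'T hom1 hom2]]]] := jep N M NT MT.
have [_ imm] := ec _ _ N'T hom2.
(* An empty tuple of parameters is adjoined, so that [ex_tuple] yields a sentence in a finite
   context, as immersions require. *)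
pose w := sum_sort s (real 'I_0).
have [psi psiP] := ex_tuple (subst (fun v => @Var _ L _ w (inl v)) phi).
have [e] := env_inhabited M (real 'I_0).
have /imm/psiP[c] : sat psi (fun v => h2 _ (e v)).
  apply/psiP; exists (fun v => h1 _ (a v)); rewrite sat_subst /=.
  exact: sat_hom.
by rewrite sat_subst; apply: Mphi.
Qed.

(** * From T to its hyperimaginary extension *)

Section Translation.
Context {L : signature unit} (M : structure L) {J : Type} {len : J -> Type}
  (E : forall j, set (formula L (sum_sort (real (len j)) (real (len j))))).

Let HL := hyp_signature L len.

Fixpoint hyp_term {V W : Type} {s : V -> unit} {w : W -> unit + J}
    (f : forall v, term HL w (inl (s v))) {t : unit} (u : term L s t) :
    term HL w (inl t) :=
  match u with
  | Var v => f v
  | App g args => @App _ HL _ w g (fun i => hyp_term f (args i))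
  end.

Definition hyp_up {V W : Type} {s : V -> unit} {w : W -> unit + J} {t : unit}
    (f : forall v, term HL w (inl (s v))) (u : option V) :
    term HL (ext_sort w (inl t)) (inl (ext_sort s t u)) :=
  match u with
  | Some v => term_subst (fun v => @Var _ HL _ (ext_sort w (inl t)) (Some v)) (f v)
  | None => @Var _ HL _ (ext_sort w (inl t)) None
  end.

Fixpoint hyp_formula {V W : Type} {s : V -> unit} {w : W -> unit + J}
    (f : forall v, term HL w (inl (s v))) (phi : formula L s) : formula HL w :=
  match phi with
  | Rel r args => @Rel _ HL _ w (inl r) (fun i => hyp_term f (args i))
  | Eq t t1 t2 => Eq (hyp_term f t1) (hyp_term f t2)
  | Top => Top _ _
  | Bot => Bot _ _
  | And phi psi => And (hyp_formula f phi) (hyp_formula f psi)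
  | Or phi psi => Or (hyp_formula f phi) (hyp_formula f psi)
  | Ex t phi => Ex (hyp_formula (hyp_up f) phi)
  end.

Let HM := hyp_structure M E.

Lemma eval_hyp_term V W (s : V -> unit) (w : W -> unit + J)
    (f : forall v, term HL w (inl (s v))) t (u : term L s t) (a : env HM w) :
  eval a (hyp_term f u) = eval (M := M) (fun v => eval a (f v)) u.
Proof.
elim: u => //= g args IH; congr fint; exact: functional_extensionality_dep.
Qed.

(** The real sort of the extension is [M] itself, and translated quantifiers range over it. *)
Lemma sat_hyp_formula V W (s : V -> unit) (w : W -> unit + J)
    (f : forall v, term HL w (inl (s v))) (phi : formula L s) (a : env HM w) :
  sat (hyp_formula f phi) a <-> sat (M := M) phi (fun v => eval a (f v)).
Proof.
elim: phi W w f a => {V s} [V s r args|V s t t1 t2|V s|V s|V s p IHp q IHq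
  |V s p IHp q IHq|V s t p IHp] W w f a //=.
- set e1 := (X in rint X); set e2 := (X in _ <-> rint X).
  have -> // : e1 = e2.
  by apply: functional_extensionality_dep => i; rewrite /e1 eval_hyp_term.
- by rewrite !eval_hyp_term.
- by rewrite IHp IHq.
- by rewrite IHp IHq.
- have fE (x : M t) : (fun v => eval (ext_env (t := inl t) a x) (hyp_up f v)) =
      ext_env (M := M) (fun v => eval a (f v)) x.
    apply: functional_extensionality_dep => -[v|] //=.
    by rewrite eval_subst.
  by split=> -[x]; [rewrite IHp fE|rewrite -fE -IHp] => ?; exists x.
Qed.

(** The identity on variables, written as a substitution because [inl] commutes with [sum_sort] only
    pointwise. *)
Definition hyp_pair_var {V W : Type} (s : V -> unit) (t : W -> unit) (u : V + W) :
    term HL (sum_sort (fun v => inl (s v)) (fun w => inl (t w)))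
      (inl (sum_sort s t u)) :=
  let st := sum_sort (fun v => inl (s v)) (fun w => inl (t w)) in
  match u with
  | inl v => @Var _ HL _ st (inl v)
  | inr w => @Var _ HL _ st (inr w)
  end.

Lemma sat_hyp_pair_var V W (s : V -> unit) (t : W -> unit)
    (phi : formula L (sum_sort s t)) (a : env M s) (b : env M t) :
  sat (hyp_formula (hyp_pair_var s t) phi)
    (sum_env (M := HM) (s := fun v => inl (s v)) (t := fun w => inl (t w)) a b) <->
  sat phi (sum_env a b).
Proof.
rewrite sat_hyp_formula; set e := (X in sat phi X).
have -> // : e = sum_env a b by apply: functional_extensionality_dep => -[].
Qed.

Lemma hyp_SOP1 (T : theory L) n m (sx : 'I_n -> unit) (sy : 'I_m -> unit)
    (phi : formula L (sum_sort sx sy)) :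
  is_model T M -> has_SOP1 T M phi ->
  has_SOP1 (hyp_theory M E) HM (hyp_formula (hyp_pair_var sx sy) phi).
Proof.
move=> MT [psi [a [branch unsat path]]].
exists (hyp_formula (hyp_pair_var sy sy) psi), a; split.
- move=> sigma; have [b bP] := branch sigma; exists b => k.
  exact/sat_hyp_pair_var/bP.
- move=> N NT y1 y2 [psi12 [x phi12]].
  (* Clause (ii) for [T], read in [M], is an inconsistency in the extension; it thus belongs to
     [hyp_theory] and holds in [N]. *)
  apply: ((unsat_clash N _ _).2 (unsat_model NT _) x y1 y2 (conj psi12 phi12)).
  apply/unsat_clash => x' z1 z2; rewrite !sat_hyp_pair_var => -[p q].
  by apply: (unsat M MT z1 z2); split=> //; exists x'.
- by move=> eta nu /path; rewrite sat_hyp_pair_var.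
Qed.

End Translation.

(** * From the hyperimaginary extension to T *)

Lemma finite_set_range V (D : set V) : finite_set D ->
  exists (n : nat) (f : 'I_n -> V), injective f /\ D `<=` range f.
Proof.
move=> /finite_set_list[l [ul ->]].
exists (size l), (tnth (in_tuple l)); split.
  by have /tuple_uniqP := ul : uniq (in_tuple l).
by move=> v /= vl; have /tnthP[i ->] : (v : {classic V}) \in in_tuple l by []; exists i.
Qed.

(** Places outside the range of [f] get arbitrary values. Injectivity of [f] makes the prescribed
    values unambiguous, and [eq_rect] moves them to the right sort. *)
Lemma env_extend (S : Type) (L : signature S) (M : structure L) V V' (s : V -> S)
    (f : V' -> V) (a : env M (fun v' => s (f v'))) :
  injective f -> exists b : env M s, a = fun v' => b (f v').
Proof.
move=> fI.
have b v : {x : M (s v) | forall v' (e : f v' = v),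
    eq_rect _ (fun v => M (s v)) (a v') _ e = x}.
  have [/cid[v' e]|nf] := pselect (exists v', f v' = v).
    case: v / e; exists (a v') => v'' e.
    by have e' := fI _ _ e; subst v''; rewrite (Prop_irrelevance e erefl).
  apply: cid; have [x] := carrier_inhabited M (s v).
  by exists x => v' e; case: nf; exists v'.
exists (fun v => sval (b v)); apply: functional_extensionality_dep => v'.
by rewrite -(svalP (b (f v')) v' erefl).
Qed.

(** Compactness: if all consequences [phi] of [P] and [psi] of [Q] had a consistent clash,
    saturation would realise all these clashes at once, and the realisation would lie in [P] and
    [Q]. *)
Lemma type_definable_clash K (L : signature unit) (T : theory L) (M : structure L)
    X Y (sx : X -> unit) (sy : Y -> unit)
    (P : env M (sum_sort sx sy) -> Prop) (Q : env M (sum_sort sy sy) -> Prop) :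
  monster K T M -> small K X -> small K Y -> type_definable P -> type_definable Q ->
  (forall x y1 y2,
     ~ [/\ Q (sum_env y1 y2), P (sum_env x y1) & P (sum_env x y2)]) ->
  exists phi psi, [/\ forall a, P a -> sat phi a, forall a, Q a -> sat psi a &
    forall a : env M (sum_sort sx (sum_sort sy sy)), ~ sat (clash phi psi) a].
Proof.
move=> mM smX smY cP cQ PQ; apply: contrapT => H.
pose sxyy := sum_sort sx (sum_sort sy sy).
pose st := sum_sort sxyy (real 'I_0).
have [e] := env_inhabited M (real 'I_0).
(* [Sigma] collects whatever follows in [M] from a single clash; two clashes are merged by
   conjunction, which gives finite satisfiability. *)
pose Sigma (chi : formula L st) := exists phi psi,
  [/\ forall a, P a -> sat phi a, forall a, Q a -> sat psi a &
    forall x y1 y2, [/\ sat psi (sum_env y1 y2), sat phi (sum_env x y1) &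
      sat phi (sum_env x y2)] -> sat chi (sum_env (sum_env x (sum_env y1 y2)) e)].
have [| | |b bP] := @monster_saturated _ _ _ _ _ mM _ _ sxyy (real 'I_0) e _ _ Sigma.
- by do ?apply: small_sum => //; apply: monster_nat mM.
- by apply: small_embeds (monster_nat mM); exists val; apply: val_inj.
- move=> Delta /finite_set_list[l [_ ->]] lP.
  suff [phi [psi [Pphi Qpsi clashl]]] : exists phi psi,
      [/\ forall a, P a -> sat phi a, forall a, Q a -> sat psi a &
      forall x y1 y2, [/\ sat psi (sum_env y1 y2), sat phi (sum_env x y1) &
        sat phi (sum_env x y2)] ->
        sat (bigAnd l) (sum_env (sum_env x (sum_env y1 y2)) e)].
    apply: contrapT => nl; apply: H; exists phi, psi; split=> //.
    apply/unsat_clash => x y1 y2 [p12 [p1 p2]]; apply: nl.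
    exists (sum_env x (sum_env y1 y2)) => chi.
    by apply: (sat_bigAnd _ _).1; apply: clashl.
  elim: l lP => [|chi l IH] lP.
    by exists (Top _ _), (Top _ _).
  have [|phi1 [psi1 [P1 Q1 c1]]] := IH.
    by move=> q ql; apply: lP; rewrite /= in_cons; apply/orP; right.
  have [|phi2 [psi2 [P2 Q2 c2]]] := lP chi; first by rewrite /= in_cons eqxx.
  exists (And phi1 phi2), (And psi1 psi2); split=> [a Pa|a Qa|x y1 y2] /=.
  + by split; [apply: P1|apply: P2].
  + by split; [apply: Q1|apply: Q2].
  by move=> [[? ?] [? ?] [? ?]]; split; [apply: c2|apply: c1].
rewrite -(sum_env_eta b) -(sum_env_eta (fun u => b (inr u))) in bP.
move: (fun u => b (inl u)) (fun u => b (inr (inl u))) (fun u => b (inr (inr u))) bP.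
move=> x y1 y2 bP; apply: (PQ x y1 y2).
(* Each required consequence lies in [Sigma], with [Top] in place of the other formula of the
   clash. *)
split; [apply: cQ => psi Qpsi|apply: cP => phi Pphi|apply: cP => phi Pphi].
- have := bP (subst (subst_sum (fun i => @Var _ L _ st (inl (inr (inl i))))
    (fun i => @Var _ L _ st (inl (inr (inr i))))) psi).
  rewrite sat_subst_sum; apply.
  by exists (Top _ _), psi; split=> // x' z1 z2 [? _ _]; rewrite sat_subst_sum.
- have := bP (subst (subst_sum (fun i => @Var _ L _ st (inl (inl i)))
    (fun i => @Var _ L _ st (inl (inr (inl i))))) phi).
  rewrite sat_subst_sum; apply.
  by exists phi, (Top _ _); split=> // x' z1 z2 [_ ? _]; rewrite sat_subst_sum.
- have := bP (subst (subst_sum (fun i => @Var _ L _ st (inl (inl i)))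
    (fun i => @Var _ L _ st (inl (inr (inr i))))) phi).
  rewrite sat_subst_sum; apply.
  by exists phi, (Top _ _); split=> // x' z1 z2 [_ _ ?]; rewrite sat_subst_sum.
Qed.

Section Representation.
Context {L : signature unit} (M : structure L) {J : Type} {len : J -> Type}
  (E : forall j, set (formula L (sum_sort (real (len j)) (real (len j))))).

Definition places {V : Type} (s : V -> unit + J) : Type :=
  {v : V & place (len := len) (s v)}.

Definition places_sort {V : Type} (s : V -> unit + J) (p : places s) : unit :=
  place_sort (s (tag p)).

Definition class_env {V : Type} (s : V -> unit + J) (c : env M (places_sort (s := s))) :
    env (hyp_structure M E) s :=
  fun v => to_hyp E (fun p => c (existT _ v p)).

Lemma class_env_surj V (s : V -> unit + J) (b : env (hyp_structure M E) s) :
  exists c, class_env c = b.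
Proof.
pose c v := cid (to_hyp_surj (b v)).
exists (fun p => sval (c (tag p)) (tagged p)).
by apply: functional_extensionality_dep => v; rewrite -[RHS](svalP (c v)).
Qed.

Definition pair_var {V W : Type} (s : V -> unit + J) (t : W -> unit + J) (u : V + W) :
    place (sum_sort s t u) ->
    term L (sum_sort (places_sort (s := s)) (places_sort (s := t)))
      (place_sort (sum_sort s t u)) :=
  let st := sum_sort (places_sort (s := s)) (places_sort (s := t)) in
  match u with
  | inl v => fun p => @Var _ L _ st (inl (existT _ v p))
  | inr w => fun p => @Var _ L _ st (inr (existT _ w p))
  end.

Lemma hyp_env_pair_var V W (s : V -> unit + J) (t : W -> unit + J)
    (c : env M (places_sort (s := s))) (d : env M (places_sort (s := t))) :
  hyp_env (M := M) E (@pair_var _ _ s t) (sum_env c d) =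
  sum_env (class_env c) (class_env d).
Proof. by apply: functional_extensionality_dep => -[]. Qed.

Lemma SOP1_of_hyp K (T : theory L) n m (sx : 'I_n -> unit + J)
    (sy : 'I_m -> unit + J) (phi : formula (hyp_signature L len) (sum_sort sx sy)) :
  JEP T -> monster K T M -> (forall j, small K (len j)) ->
  (forall j, RelationClasses.Equivalence (Erel M E j)) ->
  has_SOP1 (hyp_theory M E) (hyp_structure M E) phi -> ~ NSOP1 T M.
Proof.
move=> jep mM slen eqE [psi [a [branch unsat path]]].
have smP k (s : 'I_k -> unit + J) : small K (places s).
  apply: small_tag_ord => [|i]; first exact: monster_nat mM.
  exact: small_place mM slen _.
have cP := type_definable_hyp_sat eqE mM slen (phi := phi) (f := @pair_var _ _ sx sy)
  (small_sum (monster_nat mM) (smP _ sx) (smP _ sy)).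
have cQ := type_definable_hyp_sat eqE mM slen (phi := psi) (f := @pair_var _ _ sy sy)
  (small_sum (monster_nat mM) (smP _ sy) (smP _ sy)).
have [|phi0 [psi0 [Pphi Qpsi unsat0]]] :=
  type_definable_clash mM (smP _ sx) (smP _ sy) cP cQ.
  move=> x y1 y2; rewrite !hyp_env_pair_var => -[psi12 phi1 phi2].
  (* Clause (ii) is applied to the extension, a model of its own theory. *)
  apply: (unsat (hyp_structure M E) (fun chi => id) (class_env y1) (class_env y2)).
  by split=> //; exists (class_env x).
have [n' [fx [fxI fxP]]] := finite_set_range
  (finite_preimage (f := inl) (fun x y _ _ e => inl_inj e) (finite_vars phi0)).
(* One enumeration serves for [y1] and [y2], which share a context: it covers the [y] places of
   [phi0] and both sides of [psi0]. *)
have [|m' [fy [fyI fyP]]] := @finite_set_range _ (inr @^-1` vars phi0 `|`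
    (inl @^-1` vars psi0 `|` inr @^-1` vars psi0)).
  rewrite !finite_setU; split; last split;
    by apply: finite_preimage; [move=> ? ? _ _ []|exact: finite_vars].
have [phi1 phi1P] := restrict_sum_vars fxP (fun v pv => fyP v (or_introl pv)).
have [psi1 psi1P] := restrict_sum_vars (f := fy) (g := fy) (phi := psi0)
  (fun v pv => fyP v (or_intror (or_introl pv)))
  (fun v pv => fyP v (or_intror (or_intror pv))).
have /choice[d dE] : forall eta, exists c, class_env c = a eta.
  by move=> eta; apply: class_env_surj.
move=> /(_ _ _ _ _ phi1); apply.
exists psi1, (fun eta i => d eta (fy i)); split.
- move=> sigma; have [b bP] := branch sigma.
  (* Representatives of the realisation, cut down to the places in [fx]; [phi0] holds there as a
     consequence of [phi]. *)
  have [c cb] := class_env_surj b; exists (fun i => c (fx i)) => k.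
  by apply/phi1P/Pphi; rewrite hyp_env_pair_var cb dE.
- move=> N NT y1 y2 [psi12 [x phi12]].
  apply: ((unsat_clash N _ _).2 (unsat_JEP jep (monster_ec mM) NT _) x y1 y2
    (conj psi12 phi12)).
  (* In [M], the finite tuples extend to full tuples of representatives, where [unsat0] applies. *)
  apply/unsat_clash => x' z1 z2.
  have [x'' ->] := env_extend x' fxI.
  have [z1' ->] := env_extend z1 fyI.
  have [z2' ->] := env_extend z2 fyI.
  by rewrite !phi1P psi1P; apply: (unsat_clash _ _ _).2 unsat0 _ _ _.
- move=> eta nu /path psia.
  by apply/psi1P/Qpsi; rewrite hyp_env_pair_var !dE.
Qed.

End Representation.

Theorem theorem10p18 (K : Type) (L : signature unit) (T : theory L)
  (M : structure L) (J : Type) (len : J -> Type)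
  (E : forall j : J, set (formula L (sum_sort (real (len j)) (real (len j))))) :
  JEP T ->
  monster K T M ->
  (forall j : J, small K (len j)) ->
  (forall j : J, RelationClasses.Equivalence (Erel M E j)) ->
  NSOP1 T M <-> NSOP1 (hyp_theory M E) (hyp_structure M E).
Proof.
move=> jep mM slen eqE; split=> [nT n m sx sy phi sop|nE n m sx sy phi sop].
  exact: SOP1_of_hyp jep mM slen eqE sop nT.
exact: nE (hyp_SOP1 E (monster_ec mM).1 sop).
Qed.
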